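(* Let $n\ge1$ and $d\ge1$. Suppose that $X\sim\mathcal U[0,1]^d$, that $g(x)=\sum_{k=1}^dx_k$, and that the noise $\epsilon=Y-g(X)$ is sub-Gaussian conditionally on $X$ with parameter $\sigma^2$. Consider a local map $\mathcal V$ such that $\mathcal V(0)=\prod_{k=1}^d[0,h_k]$. Let $\bar\gamma>0$ be such that $\operatorname{diam}(\mathcal V(0))^d/\lambda(\mathcal V(0))\ge\bar\gamma$. Whenever $2^{d+4}\log(2)\le n\prod_{k=1}^dh_k$, there exists a constant $C_d>0$ depending only on $d$ such that $$\mathbb E\big[(\hat g_{\mathcal V}(0)-g(0))^2\big]^{1/2}\ \ge\ C_d\left(\frac{\bar\gamma\,\sigma^2}{n}\right)^{1/(d+2)}.$$
   Context: $(X_1,Y_1),\dots,(X_n,Y_n)$ are i.i.d. copies of $(X,Y)$, where $X$ takes values in $S_X=[0,1]^d$, $Y$ is real valued and $g(x)=\mathbb E[Y\mid X=x]$. Conditionally sub-Gaussian with parameter $\sigma^2$: $\mathbb E[\epsilon\mid X]=0$ and $\mathbb E[\exp(t\epsilon)\mid X]\le\exp(\sigma^2t^2/2)$ for all $t\in\mathbb R$. (In particular $\mathbb E[\epsilon^2\mid X]\le\sigma^2$ almost surely.) A local map is a map $\mathcal V$ from $S_X$ to the Borel subsets of $S_X$ with $x\in\mathcal V(x)$ for all $x\in S_X$. The associated estimator is $\hat g_{\mathcal V}(x)=\frac{\sum_{i=1}^nY_i\mathbf 1_{\mathcal V(x)}(X_i)}{\sum_{i=1}^n\mathbf 1_{\mathcal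 V(x)}(X_i)}$, with the convention $0/0=0$. $\lambda$ is Lebesgue measure on $\mathbb R^d$ and $\operatorname{diam}(V)=\sup_{x,y\in V}\|x-y\|_2$.
   Formalization: The noise is additionally assumed to have conditional variance exactly σ², i.e. E[ε²|X]=σ² almost surely; with sub-Gaussianity of parameter σ² alone the claim fails (e.g. ε=0 with σ arbitrarily large). *)

(* Defs.v *)
From mathcomp Require Export all_boot all_order all_algebra.
From mathcomp Require Export all_classical all_reals all_analysis.

Set Implicit Arguments.
Unset Strict Implicit.
Unset Printing Implicit Defensive.

Export Order.TTheory GRing.Theory Num.Theory.
Export numFieldNormedType.Exports.

#[global] Open Scope classical_set_scope.
#[global] Open Scope ring_scope.

(** The space R^d is [d.-tuple R]; the sigma-algebra the library puts on it is
    the one generated by the coordinates, i.e. the Borel sigma-algebra. *)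

Definition zero_vec (R : realType) (d : nat) : d.-tuple R := [tuple 0 | _ < d].

Definition unit_cube (R : realType) (d : nat) : set (d.-tuple R) :=
  [set x | forall k : 'I_d, 0 <= tnth x k <= 1].

Definition corner_box (R : realType) (d : nat) (h : 'I_d -> R) :
    set (d.-tuple R) :=
  [set x | forall k : 'I_d, 0 <= tnth x k <= h k].

(** Lebesgue measure on R^d, as the iterated product of the one-dimensional
    Lebesgue measure (Dirac mass on the one-point space R^0), transported along
    the identification R * R^d = R^(d+1). *)
Fixpoint lebesgue_tuple (R : realType) (d : nat) : set (d.-tuple R) -> \bar R :=
  match d return set (d.-tuple R) -> \bar R with
  | 0%N => fun A => \d_([tuple] : 0.-tuple R) A
  | d'.+1 => pushforward
      (product_measure1 (@lebesgue_measure R) (@lebesgue_tuple R d'))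
      (fun p : measurableTypeR R * d'.-tuple R =>
         [tuple of (p.1 : R) :: p.2] : d'.+1.-tuple R)
  end.
Arguments lebesgue_tuple {R} d _.

Definition dist2 (R : realType) (d : nat) (x y : d.-tuple R) : R :=
  Num.sqrt (\sum_(k < d) (tnth x k - tnth y k) ^+ 2).

(** [sup] is the real supremum: this is the diameter of nonempty bounded sets. *)
Definition diam (R : realType) (d : nat) (A : set (d.-tuple R)) : R :=
  sup [set r | exists x y, [/\ A x, A y & r = dist2 x y]].

Section RandomElements.
Context {dO dE : measure_display} {Omega : measurableType dO}
  {E : measurableType dE} {R : realType} (P : probability Omega R).

Definition identically_distributed (Z Z' : Omega -> E) : Prop :=
  forall A : set E, measurable A -> P (Z @^-1` A) = P (Z' @^-1` A).

Definition mutually_independent (n : nat) (Z : 'I_n -> Omega -> E) : Prop :=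
  forall (J : {set 'I_n}) (A : 'I_n -> set E),
    (forall i, measurable (A i)) ->
    P (\bigcap_(i in [set` J]) (Z i @^-1` A i)) =
    (\prod_(i in J) P (Z i @^-1` A i))%E.

(** [Z 1], ..., [Z n] are i.i.d. copies of [Z0]. *)
Definition iid_copies (n : nat) (Z : 'I_n -> Omega -> E) (Z0 : Omega -> E) :
    Prop :=
  (forall i, identically_distributed (Z i) Z0) /\ mutually_independent Z.

(** [m] is a version of E[Z | X = . ], i.e. [m \o X] is a version of the
    conditional expectation of the integrable variable [Z] given the
    sigma-algebra generated by [X]. *)
Definition is_condexp (X : Omega -> E) (Z : Omega -> R) (m : E -> R) : Prop :=
  [/\ measurable_fun setT m,
      P.-integrable setT (EFin \o Z),
      P.-integrable setT (EFin \o (m \o X)) &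
      forall B : set E, measurable B ->
        (\int[P]_(w in X @^-1` B) (Z w)%:E =
         \int[P]_(w in X @^-1` B) (m (X w))%:E)%E].

(** E[eps | X] = 0, and E[exp (t eps) | X] <= exp (s2 t^2 / 2) almost surely
    for every real t. *)
Definition cond_subgaussian (X : Omega -> E) (eps : Omega -> R) (s2 : R) :
    Prop :=
  is_condexp X eps (cst 0) /\
  forall t : R, exists2 m : E -> R,
    is_condexp X (fun w => expR (t * eps w)) m &
    {ae P, forall w, m (X w) <= expR (s2 * t ^+ 2 / 2)}.

(** E[eps^2 | X] = s2. *)
Definition cond_second_moment (X : Omega -> E) (eps : Omega -> R) (s2 : R) :
    Prop :=
  is_condexp X (fun w => eps w ^+ 2) (cst s2).

End RandomElements.

Definition uniform_on_cube (R : realType) (d : nat) (dO : measure_display)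
    (Omega : measurableType dO) (P : probability Omega R)
    (X : Omega -> d.-tuple R) : Prop :=
  forall A : set (d.-tuple R), measurable A ->
    P (X @^-1` A) = lebesgue_tuple d (A `&` @unit_cube R d).

(** Only the values of [V] on the unit cube matter. *)
Definition local_map (R : realType) (d : nat)
    (V : d.-tuple R -> set (d.-tuple R)) : Prop :=
  forall x, unit_cube x ->
    [/\ measurable (V x), V x `<=` @unit_cube R d & V x x].

(** Division by zero yields zero, which gives the convention 0/0 = 0 when no
    [X i] falls in [V x]. *)
Definition local_estimator (R : realType) (d n : nat) (Omega : Type)
    (V : d.-tuple R -> set (d.-tuple R))
    (X : 'I_n -> Omega -> d.-tuple R) (Y : 'I_n -> Omega -> R)
    (x : d.-tuple R) (w : Omega) : R :=
  (\sum_(i < n) Y i w * \1_(V x) (X i w)) / (\sum_(i < n) \1_(V x) (X i w)).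

(* Main.v *)
From HB Require Import structures.
Require Import Defs.
From mathcomp Require Import measurable_realfun ring lra.

Set Implicit Arguments.
Unset Strict Implicit.
Unset Printing Implicit Defensive.

(** Write [B] for the corner box, [p] for its volume, [H] for the sum of its
    side lengths, [T] for the sum of the responses falling in [B] and [N] for
    their number, so that the estimation error at the origin is [T / N].  The
    theorem follows from
      E (T / N)^2 >= c (H^2 + sigma^2 / (n p)),
    a squared bias plus a variance: the diameter of [B] is at most [H], so
    gammabar p <= H^d, and the two terms cannot both be below the stated rate
    ([rate_of_two_terms]).

    The random denominator is removed by convexity instead of conditioning on
    [N].  The tangent line of x |-> x^-2 at [m] gives
      (T / N)^2 >= (3 T^2 - (2 / m) T^2 N) / m^2,
    whose expectation involves only moments of at most three observations
    ([inv_sqr_tangent]).  With U_i the response of observation [i] when it falls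
    in [B] and [0] otherwise, independence gives E (U_i U_j N) <= m E (U_i U_j)
    for m = 2 + n p, whence
      E (T / N)^2 >= (n b + n (n - 1) a^2) / m^2,
      a = E U_1,  b = E U_1^2
    ([local_mean_sqr_ge]).

    It remains to bound [a] and [b] from below.  For [a], each coordinate is at
    least half of its side length outside a half box ([response_mean_ge]).  For
    [b], the pointwise inequality (e + g)^2 >= e^2 / 9 - g^2 / 8 avoids the
    cross term between noise and regression ([response_second_moment_ge]); the
    loss in g^2 is of order H^2 p, negligible before n a^2 because n p >= 16
    ([bias_variance_lower_bound]). *)

(** * The tangent inequality *)

(** The left-hand side is [T ^+ 2] times (3 - 2 N / m) / m^2, the value at [N] of
    the tangent line at [m] to the convex function x |-> x^-2.  The case
    [N = 0], where both sides vanish, is the one of an empty neighbourhood. *)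
Lemma inv_sqr_tangent (R : realType) (T N m : R) :
  0 < m -> 0 <= N -> (N = 0 -> T = 0) ->
  (m ^+ 2)^-1 * (3 * T ^+ 2 - 2 / m * (T ^+ 2 * N)) <= (T / N) ^+ 2.
Proof.
move=> m0; rewrite le_eqVlt => /predU1P[<- /(_ erefl) ->|N0 _].
  by rewrite mul0r expr0n/= mul0r !mulr0 subrr mulr0.
have -> : (m ^+ 2)^-1 * (3 * T ^+ 2 - 2 / m * (T ^+ 2 * N)) =
    (T / N) ^+ 2 - (T / N) ^+ 2 * ((m - N) ^+ 2 * (m + 2 * N) / m ^+ 3).
  by field; rewrite !gt_eqF.
rewrite lerBlDr lerDl; apply: mulr_ge0; first exact: sqr_ge0.
apply: divr_ge0; last by rewrite exprn_ge0// ltW.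
by apply: mulr_ge0; [exact: sqr_ge0|lra].
Qed.

(** * Real-valued integrals *)

Lemma integrable_mulrl d (T : measurableType d) (R : realType)
    (mu : {measure set T -> \bar R}) (k : R) (f : T -> R) :
  mu.-integrable setT (EFin \o f) ->
  mu.-integrable setT (EFin \o (fun x => k * f x)).
Proof. by move=> intf; exact: (integrableZl measurableT k intf). Qed.

Lemma integrable_sumR d (T : measurableType d) (R : realType)
    (mu : {measure set T -> \bar R}) (I : Type) (s : seq I) (F : I -> T -> R) :
  (forall i, mu.-integrable setT (EFin \o F i)) ->
  mu.-integrable setT (EFin \o (fun x => \sum_(i <- s) F i x)).
Proof.
move=> iF.
have := @integrable_sum _ _ _ mu setT measurableT I s predT _ (fun i _ => iF i).
apply: eq_integrable => // x _ /=.
by elim/big_ind2: _ => // [u _ v _ -> ->].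
Qed.

Lemma Rintegral_sum d (T : measurableType d) (R : realType)
    (mu : {measure set T -> \bar R}) (I : Type) (s : seq I) (F : I -> T -> R) :
  (forall i, mu.-integrable setT (EFin \o F i)) ->
  \int[mu]_x (\sum_(i <- s) F i x) = \sum_(i <- s) \int[mu]_x F i x.
Proof.
move=> iF; elim: s => [|i s IH].
  rewrite big_nil; under eq_Rintegral do rewrite big_nil.
  by rewrite Rintegral_cst// mul0r.
rewrite big_cons -IH -RintegralD//; last exact: integrable_sumR.
by under eq_Rintegral do rewrite big_cons.
Qed.

Lemma Rintegral_preimage (dO : measure_display) (Omega : measurableType dO)
    (E : Type) (R : realType) (P : {measure set Omega -> \bar R})
    (X : Omega -> E) (B : set E) (f : Omega -> R) :
  \int[P]_(w in X @^-1` B) f w = \int[P]_w (f w * \1_B (X w)).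
Proof.
rewrite Rintegral_mkcond; apply: eq_Rintegral => w _.
rewrite patchE indicE; have [wB|wB] := boolP (X w \in B).
  by rewrite mem_set ?mulr1//; exact: set_mem wB.
by rewrite memNset ?mulr0// => Bw; move/negP: wB; apply; exact: mem_set.
Qed.

(** * Independence and expectations of products *)

Section independence.
Context {dO d1 d2 : measure_display} {Omega : measurableType dO}
  {E1 : measurableType d1} {E2 : measurableType d2}
  {R : realType} (P : probability Omega R).

Definition independent_pair (Z1 : Omega -> E1) (Z2 : Omega -> E2) : Prop :=
  forall A B, measurable A -> measurable B ->
    P (Z1 @^-1` A `&` Z2 @^-1` B) = (P (Z1 @^-1` A) * P (Z2 @^-1` B))%E.

End independence.

Section product_law.
Context {dO d1 d2 : measure_display} {Omega : measurableType dO}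
  {E1 : measurableType d1} {E2 : measurableType d2}
  {R : realType} (P : probability Omega R).
Variables (Z1 : {RV P >-> E1}) (Z2 : {RV P >-> E2}).

Let Z12 : Omega -> E1 * E2 := fun w => (Z1 w, Z2 w).

Let mZ12 : measurable_fun setT Z12.
Proof. by apply: measurable_fun_pair. Qed.

HB.instance Definition _ := isMeasurableFun.Build _ _ _ _ Z12 mZ12.

(** Independence fixes the joint law on rectangles, and these determine a
    measure on the product. *)
Lemma independent_joint_law : independent_pair P Z1 Z2 ->
  forall B : set (E1 * E2), measurable B ->
    (distribution P Z1 \x distribution P Z2)%E B = P (Z12 @^-1` B).
Proof.
move=> indep; apply: (@product_measure_unique _ _ _ _ _
  (distribution P Z1) (distribution P Z2) (distribution P Z12)).
by move=> A B mA mB; exact: indep.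
Qed.

Section integrals.
Variables (f : E1 -> R) (g : E2 -> R).
Hypotheses (mf : measurable_fun setT f) (mg : measurable_fun setT g).
Hypothesis indep : independent_pair P Z1 Z2.
Hypothesis intf : P.-integrable setT (EFin \o (f \o Z1)).
Hypothesis intg : P.-integrable setT (EFin \o (g \o Z2)).

Let fg : E1 * E2 -> R := fun z => f z.1 * g z.2.

Let mfg : measurable_fun setT fg.
Proof. by apply: measurable_funM; exact: measurableT_comp. Qed.

Let mEfg : measurable_fun setT (EFin \o fg).
Proof. exact/measurable_EFinP. Qed.

Let imf : (distribution P Z1).-integrable setT (EFin \o f).
Proof. by apply: integrable_pushforward => //; exact/measurable_EFinP. Qed.

Let img : (distribution P Z2).-integrable setT (EFin \o g).
Proof. by apply: integrable_pushforward => //; exact/measurable_EFinP. Qed.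

Let imfg :
  (distribution P Z1 \x distribution P Z2)%E.-integrable setT (EFin \o fg).
Proof.
apply/integrable12ltyP => //.
have /integrableP[_ fy] := imf; have /integrableP[_ gy] := img.
under eq_integral => x _.
  under eq_integral do rewrite /fg /= normrM EFinM.
  rewrite ge0_integralZl//; last first.
    by apply/measurable_EFinP; exact: measurableT_comp.
  over.
rewrite ge0_integralZr//; last 2 first.
  by apply/measurable_EFinP; exact: measurableT_comp.
  exact: integral_ge0.
rewrite lte_mul_pinfty//; first exact: integral_ge0.
by rewrite ge0_fin_numE//; exact: integral_ge0.
Qed.

(** By Tonelli, the integral of |f| |g| for the product law factorizes. *)
Lemma independent_integrableM :
  P.-integrable setT (EFin \o (fun w => f (Z1 w) * g (Z2 w))).
Proof.
apply/integrableP; split.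
  by apply/measurable_EFinP; apply: measurable_funM; exact: measurableT_comp.
have /integrableP[_] := imfg.
rewrite (@eq_measure_integral _ _ _ _ (distribution P Z12)); last first.
  by move=> A mA _; exact: independent_joint_law.
by rewrite ge0_integral_distribution//; exact: measurableT_comp.
Qed.

Lemma independent_RintegralM :
  \int[P]_w (f (Z1 w) * g (Z2 w)) = (\int[P]_w f (Z1 w)) * \int[P]_w g (Z2 w).
Proof.
rewrite /Rintegral.
have -> : (\int[P]_x (f (Z1 x) * g (Z2 x))%:E =
    \int[distribution P Z12]_z (fg z)%:E)%E.
  rewrite integral_distribution//; exact: independent_integrableM.
rewrite -(@eq_measure_integral _ _ _ _ _
  (distribution P Z1 \x distribution P Z2)%E); last first.
  by move=> A mA _; exact: independent_joint_law.
rewrite -integral12_prod_meas1//=.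
have intE1 : (\int[distribution P Z1]_x (f x)%:E = \int[P]_w (f (Z1 w))%:E)%E.
  by rewrite integral_distribution//; exact/measurable_EFinP.
have intE2 : (\int[distribution P Z2]_x (g x)%:E = \int[P]_w (g (Z2 w))%:E)%E.
  by rewrite integral_distribution//; exact/measurable_EFinP.
rewrite /fubini_F; under eq_integral => x _.
  under eq_integral do rewrite /fg /= EFinM.
  rewrite integralZl//.
  over.
have gfin : (\int[P]_w (g (Z2 w))%:E = (fine (\int[P]_w (g (Z2 w))%:E))%:E)%E.
  by rewrite fineK//; exact: integrable_fin_num.
by rewrite /= intE2 gfin integralZr// intE1 fineM//; exact: integrable_fin_num.
Qed.

End integrals.
End product_law.

Section triple.
Context {dO d1 d2 d3 : measure_display} {Omega : measurableType dO}
  {E1 : measurableType d1} {E2 : measurableType d2} {E3 : measurableType d3}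
  {R : realType} (P : probability Omega R).
Variables (Z1 : {RV P >-> E1}) (Z2 : {RV P >-> E2}) (Z3 : {RV P >-> E3}).

(** For a fixed event [Z3 \in D], the restriction of [P] to it is pushed by
    [(Z1, Z2)] to a measure that equals, on rectangles, [P (Z3 \in D)] times the
    product of the laws of [Z1] and [Z2]; hence everywhere. *)
Lemma independent_pair_of_triple :
  (forall A B D, measurable A -> measurable B -> measurable D ->
    P ((Z1 @^-1` A `&` Z2 @^-1` B) `&` Z3 @^-1` D) =
    (P (Z1 @^-1` A) * P (Z2 @^-1` B) * P (Z3 @^-1` D))%E) ->
  independent_pair P Z3 (fun w => (Z1 w, Z2 w)).
Proof.
move=> indep D B mD mB.
have indep12 : independent_pair P Z1 Z2.
  move=> A A' mA mA'.
  have := indep _ _ _ mA mA' measurableT.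
  by rewrite preimage_setT setIT probability_setT mule1.
have mZ3D : measurable (Z3 @^-1` D).
  by rewrite -[X in measurable X]setTI; exact: measurable_funP.
have mZ12 : measurable_fun setT (fun w => (Z1 w, Z2 w)).
  exact: measurable_fun_pair.
have p0 : 0 <= fine (P (Z3 @^-1` D)) by rewrite fine_ge0.
pose q := NngNum p0.
have qE : (q%:num%:E)%E = P (Z3 @^-1` D) by rewrite /= fineK ?fin_num_measure.
have /= <- := @independent_joint_law _ _ _ _ _ _ _ P Z1 Z2 indep12 B mB.
(* As a measure, the pushforward takes the measurability proof as argument. *)
pose m' : {measure set (E1 * E2)%type -> \bar R} :=
  pushforward (mrestr P mZ3D) (fun w => (Z1 w, Z2 w)).
transitivity (m' mZ12 B).
  by rewrite /m' /= /pushforward /mrestr setIC.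
rewrite -(@product_measure_unique _ _ _ _ _
  (mscale q (distribution P Z1)) (distribution P Z2) (m' mZ12))//.
  rewrite /product_measure1 ge0_integral_mscale//; last first.
    exact: measurable_fun_xsection.
  by rewrite qE.
move=> A A' mA mA'.
have -> : m' mZ12 (A `*` A') =
  P ((Z1 @^-1` A `&` Z2 @^-1` A') `&` Z3 @^-1` D) by [].
rewrite indep// muleC muleA; congr (_ * _)%E.
by rewrite -qE.
Qed.

End triple.

Section mutual_independence.
Context {dO dE : measure_display} {Omega : measurableType dO}
  {E : measurableType dE} {R : realType} (P : probability Omega R).
Variables (n : nat) (Z : 'I_n -> {RV P >-> E}).
Hypothesis indep : mutually_independent P (fun i => Z i : Omega -> E).

Lemma mutually_independent_pair (i j : 'I_n) : i != j ->
  independent_pair P (Z i) (Z j).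
Proof.
move=> ij A B mA mB.
pose F (l : 'I_n) := if l == i then A else B.
have mF l : measurable (F l) by rewrite /F; case: ifP.
have := indep [set i; j]%SET mF.
rewrite big_setU1/= ?inE// big_set1 /F eqxx eq_sym (negbTE ij) => <-.
congr (P _); apply/seteqP; split => w /=.
  move=> [wA wB] l /=; rewrite !inE => /orP[] /eqP ->.
    by rewrite eqxx.
  by rewrite eq_sym (negbTE ij).
move=> w_in; split; first by have := w_in i; rewrite /= !inE !eqxx; exact.
by have := w_in j; rewrite /= !inE !eqxx orbT eq_sym (negbTE ij); exact.
Qed.

Lemma mutually_independent_triple (i j k : 'I_n) : i != j -> k != i -> k != j ->
  independent_pair P (Z k) (fun w => (Z i w, Z j w)).
Proof.
move=> ij ki kj; apply: independent_pair_of_triple => A B D mA mB mD.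
pose F (l : 'I_n) := if l == i then A else if l == j then B else D.
have mF l : measurable (F l) by rewrite /F; do 2 case: ifP => //.
have Fi : F i = A by rewrite /F eqxx.
have Fj : F j = B by rewrite /F eqxx eq_sym (negbTE ij).
have Fk : F k = D by rewrite /F (negbTE ki) (negbTE kj).
have := indep [set i; j; k]%SET mF.
rewrite finset.setUC big_setU1/= ?inE; last by rewrite negb_or ki kj.
rewrite big_setU1/= ?inE// big_set1 Fi Fj Fk muleC => <-.
congr (P _); apply/seteqP; split => w /=.
  move=> [[wA wB] wD] l /=; rewrite !inE => /orP[|/orP[]] /eqP ->.
  - by rewrite Fk.
  - by rewrite Fi.
  - by rewrite Fj.
move=> w_in; split; first split.
- by rewrite -Fi; apply: w_in; rewrite /= !inE eqxx !orbT.
- by rewrite -Fj; apply: w_in; rewrite /= !inE eqxx !orbT.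
- by rewrite -Fk; apply: w_in; rewrite /= !inE eqxx.
Qed.

End mutual_independence.

Section identical_distribution.
Context {dO dE : measure_display} {Omega : measurableType dO}
  {E : measurableType dE} {R : realType} (P : probability Omega R).
Variables (Z Z' : {RV P >-> E}) (f : E -> R).
Hypotheses (same_law : identically_distributed P Z Z')
  (mf : measurable_fun setT f)
  (intf : P.-integrable setT (EFin \o (f \o Z'))).

Let mEf : measurable_fun setT (EFin \o f).
Proof. exact/measurable_EFinP. Qed.

Lemma identically_distributed_integrable :
  P.-integrable setT (EFin \o (f \o Z)).
Proof.
apply/integrableP; split.
  by apply/measurable_EFinP; exact: measurableT_comp.
have measurable_abs_f : measurable_fun setT (abse \o (EFin \o f)).
  by apply: measurableT_comp => //; exact: mEf.
have /integrableP[_] := intf.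
have abs_f_ge0 x : (0 <= (abse \o (EFin \o f)) x)%E by exact: abse_ge0.
rewrite -(ge0_integral_distribution Z' measurable_abs_f abs_f_ge0).
rewrite -(ge0_integral_distribution Z measurable_abs_f abs_f_ge0).
rewrite (@eq_measure_integral _ _ _ _ (distribution P Z') (distribution P Z))//.
by move=> A mA _; exact: same_law.
Qed.

Lemma identically_distributed_Rintegral :
  \int[P]_w f (Z w) = \int[P]_w f (Z' w).
Proof.
rewrite /Rintegral.
rewrite -(@integral_distribution _ _ _ _ _ _ Z (EFin \o f))//; last first.
  exact: identically_distributed_integrable.
rewrite -(@integral_distribution _ _ _ _ _ _ Z' (EFin \o f))//.
by congr fine; apply: eq_measure_integral => A mA _; exact: same_law.
Qed.

End identical_distribution.

Lemma integrable_indic_preimage dO dE (Omega : measurableType dO)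
    (E : measurableType dE) (R : realType) (P : probability Omega R)
    (Z : {RV P >-> E}) (S : set E) : measurable S ->
  P.-integrable setT (EFin \o (fun w => \1_S (Z w) : R)).
Proof.
move=> mS.
apply: (@le_integrable _ _ _ _ _ measurableT _ (EFin \o cst 1)) => //.
- by apply/measurable_EFinP; exact: measurableT_comp.
- by move=> w _ /=; rewrite lee_fin normr1 indicE ger0_norm ?lern1 ?leq_b1.
- exact: finite_measure_integrable_cst.
Qed.

Lemma Rintegral_indic_preimage dO dE (Omega : measurableType dO)
    (E : measurableType dE) (R : realType) (P : probability Omega R)
    (Z : {RV P >-> E}) (S : set E) : measurable S ->
  \int[P]_w \1_S (Z w) = fine (P (Z @^-1` S)).
Proof.
move=> mS; rewrite /Rintegral.
have -> : (fun w => (\1_S (Z w))%:E) = (fun w => (\1_(Z @^-1` S) w : R)%:E).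
  by apply/funext => w; rewrite !indicE.
rewrite integral_indic ?setIT//.
by rewrite -[X in measurable X]setTI; exact: measurable_funP.
Qed.

(** * Second moment of a local average *)

Section local_mean.
Context {dO dE : measure_display} {Omega : measurableType dO}
  {E : measurableType dE} {R : realType} (P : probability Omega R).
Variables (n : nat) (Z : 'I_n -> {RV P >-> E}) (Z0 : {RV P >-> E}).
Hypothesis iid : iid_copies P (fun i => Z i : Omega -> E) Z0.
Variables (y : E -> R) (S : set E).
Hypotheses (my : measurable_fun setT y) (mS : measurable S).

Let u (z : E) : R := y z * \1_S z.

Hypothesis intu2 :
  P.-integrable setT (EFin \o (fun w => (y (Z0 w) * \1_S (Z0 w)) ^+ 2)).

Let p := fine (P (Z0 @^-1` S)).
Let a := \int[P]_w u (Z0 w).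
Let b := \int[P]_w (u (Z0 w) ^+ 2).

Let U i w := u (Z i w).
Let I i w : R := \1_S (Z i w).

Let mu_ : measurable_fun setT u.
Proof. by apply: measurable_funM => //; exact: measurable_indic. Qed.

Let muZ i : measurable_fun setT (U i).
Proof. exact: measurableT_comp. Qed.

Let mI i : measurable_fun setT (I i).
Proof. by apply: measurableT_comp => //; exact: measurable_indic. Qed.

Let p_ge0 : 0 <= p. Proof. exact: fine_ge0. Qed.

Let I_ge0 i w : 0 <= I i w. Proof. by rewrite /I indicE ler0n. Qed.
Let I_le1 i w : I i w <= 1. Proof. by rewrite /I indicE lern1 leq_b1. Qed.

Let UI i w : U i w * I i w = U i w.
Proof. by rewrite /U /I /u -mulrA !indicE -natrM mulnb andbb. Qed.

Let intU2 i : P.-integrable setT (EFin \o (fun w => U i w ^+ 2)).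
Proof.
apply: (@identically_distributed_integrable _ _ _ _ _ _ _ Z0
  (fun z => u z ^+ 2)) => //.
- exact: iid.1.
- exact: measurable_funX.
Qed.

Let b_ge0 : 0 <= b. Proof. by apply: Rintegral_ge0 => w _; exact: sqr_ge0. Qed.

Let intUU i j : P.-integrable setT (EFin \o (fun w => U i w * U j w)).
Proof.
apply: (@le_integrable _ _ _ _ _ measurableT _
  (EFin \o (fun w => U i w ^+ 2 + U j w ^+ 2))).
- by apply/measurable_EFinP; exact: measurable_funM.
- move=> w _ /=; rewrite lee_fin [leRHS]ger0_norm ?addr_ge0 ?sqr_ge0//.
  rewrite normrM -[U i w ^+ 2]real_normK ?num_real//.
  rewrite -[U j w ^+ 2]real_normK ?num_real//; nra.
- exact: (integrableD measurableT (intU2 i) (intU2 j)).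
Qed.

Let intUUI i j k :
  P.-integrable setT (EFin \o (fun w => U i w * U j w * I k w)).
Proof.
apply: (@le_integrable _ _ _ _ _ measurableT _
  (EFin \o (fun w => U i w * U j w))) => //.
- apply/measurable_EFinP; apply: measurable_funM => //.
  exact: measurable_funM.
- by move=> w _ /=; rewrite lee_fin [in leLHS]normrM ler_piMr// ger0_norm.
Qed.

Let intu : P.-integrable setT (EFin \o (u \o Z0)).
Proof.
apply: (@le_integrable _ _ _ _ _ measurableT _
  (EFin \o (fun w => 1 + u (Z0 w) ^+ 2))) => //.
- by apply/measurable_EFinP; exact: measurableT_comp.
- move=> w _ /=; rewrite lee_fin [leRHS]ger0_norm ?addr_ge0 ?sqr_ge0//.
  rewrite -[u (Z0 w) ^+ 2]real_normK ?num_real//.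
  by have := sqr_ge0 (`|u (Z0 w)| - 1); nra.
- have int_cst : P.-integrable setT (EFin \o cst 1).
    exact: finite_measure_integrable_cst.
  exact: (integrableD measurableT int_cst intu2).
Qed.

Let c i j := \int[P]_w (U i w * U j w).

Let int1 (W : {RV P >-> E}) :
  P.-integrable setT (EFin \o ((\1_S : E -> R) \o W)).
Proof. exact: integrable_indic_preimage. Qed.

Let EI i : \int[P]_w I i w = p.
Proof.
rewrite (@identically_distributed_Rintegral _ _ _ _ _ _ (Z i) Z0 (\1_S))//.
- exact: Rintegral_indic_preimage.
- exact: iid.1.
Qed.

Let EU i : \int[P]_w U i w = a.
Proof. by apply: identically_distributed_Rintegral => //; exact: iid.1. Qed.

Let c_diag i : c i i = b.
Proof.
rewrite /c /b; apply: (@identically_distributed_Rintegral _ _ _ _ _ _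
  (Z i) Z0 (fun z => u z * u z)) => //.
- exact: iid.1.
- exact: measurable_funM.
Qed.

Let intu_ i : P.-integrable setT (EFin \o (u \o Z i)).
Proof.
apply: (@identically_distributed_integrable _ _ _ _ _ _ _ Z0) => //.
exact: iid.1.
Qed.

Let c_off i j : i != j -> c i j = a ^+ 2.
Proof.
move=> ij.
rewrite /c (@independent_RintegralM _ _ _ _ _ _ _ _ (Z i) (Z j) u u)
  ?EU ?expr2//.
exact: (mutually_independent_pair iid.2).
Qed.

Let c_ge0 i j : 0 <= c i j.
Proof.
by have [->|ij] := eqVneq i j; [rewrite c_diag|rewrite c_off// sqr_ge0].
Qed.

(* The extra factor [I k] contributes its mean [p] when [k] differs from [i] and
   [j], and is absorbed by [U k] otherwise. *)
Let third_moment i j k :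
  \int[P]_w (U i w * U j w * I k w) <= c i j * ((k == i)%:R + (k == j)%:R + p).
Proof.
have [->|ki] := eqVneq k i.
  under eq_Rintegral do rewrite mulrAC UI.
  by apply: (ler_peMr (c_ge0 i j)); rewrite -addrA lerDl addr_ge0.
have [->|kj] := eqVneq k j.
  under eq_Rintegral do rewrite -mulrA UI.
  by apply: (ler_peMr (c_ge0 i j)); rewrite add0r lerDl.
rewrite !add0r.
have [ij|ij] := eqVneq i j.
  rewrite -ij; under eq_Rintegral do rewrite mulrC.
  rewrite (@independent_RintegralM _ _ _ _ _ _ _ _ (Z k) (Z i)
    (\1_S) (fun z => u z * u z))//.
  - by rewrite [X in X * _]EI mulrC.
  - exact: measurable_funM.
  - exact: (mutually_independent_pair iid.2).
  - exact: intUU.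
have mZZ : measurable_fun setT (fun w => (Z i w, Z j w)).
  exact: measurable_fun_pair.
pose ZZ : {RV P >-> (E * E)%type} :=
  HB.pack (fun w => (Z i w, Z j w)) (isMeasurableFun.Build _ _ _ _ _ mZZ).
under eq_Rintegral do rewrite mulrC.
rewrite (@independent_RintegralM _ _ _ _ _ _ _ _ (Z k) ZZ
  (\1_S) (fun z => u z.1 * u z.2))//.
- by rewrite [X in X * _]EI mulrC.
- by apply: measurable_funM; exact: measurableT_comp.
- exact: (mutually_independent_triple iid.2).
- exact: intUU.
Qed.

Let T w := \sum_(i < n) U i w.
Let N w := \sum_(i < n) I i w.

Let N_ge0 w : 0 <= N w. Proof. by apply: sumr_ge0. Qed.

Let T_eq0 w : N w = 0 -> T w = 0.
Proof.
move=> N0; rewrite /T big1// => i _; rewrite -UI.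
by rewrite (psumr_eq0P _ N0)// mulr0.
Qed.

Let mT : measurable_fun setT T.
Proof. by apply: measurable_sum. Qed.

Let mN : measurable_fun setT N.
Proof. by apply: measurable_sum. Qed.

Let T2E w : T w ^+ 2 = \sum_(i < n) \sum_(j < n) U i w * U j w.
Proof.
by rewrite expr2 /T mulr_suml; apply: eq_bigr => i _; rewrite mulr_sumr.
Qed.

Let intT2 : P.-integrable setT (EFin \o (fun w => T w ^+ 2)).
Proof.
under [X in EFin \o X]eq_fun do rewrite T2E.
by do 2 apply: integrable_sumR => ?.
Qed.

Let N_eq0_ge1 w : N w = 0 \/ 1 <= N w.
Proof.
rewrite /N /I; under eq_bigr do rewrite indicE; rewrite -natr_sum.
by case: (\sum_(_ < _) _)%N => [|k]; [left|right; rewrite ler1n].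
Qed.

Lemma local_mean_sqr_integrable : P.-integrable setT (EFin \o (fun w =>
    ((\sum_(i < n) y (Z i w) * \1_S (Z i w)) /
     (\sum_(i < n) \1_S (Z i w))) ^+ 2)).
Proof.
suff : P.-integrable setT (EFin \o (fun w => (T w / N w) ^+ 2)) by [].
(* [N] takes integer values, so [T / N] is dominated by [T]. *)
apply: (le_integrable measurableT _ _ intT2).
- apply/measurable_EFinP; apply: measurable_funX; apply: measurable_funM => //.
  (* On nonnegative reals, inversion is the measurable power function of
     exponent [-1], also at [0]. *)
  under eq_fun do rewrite -powR_inv1//.
  exact: (measurableT_comp (measurable_powR _)).
- move=> w _ /=; rewrite lee_fin !ger0_norm ?sqr_ge0//.
  have [N0|N1] := N_eq0_ge1 w.
    by rewrite N0 invr0 mulr0 expr0n sqr_ge0.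
  rewrite expr_div_n ler_pdivrMr ?exprn_gt0 ?(lt_le_trans ltr01)//.
  by rewrite ler_peMr ?sqr_ge0// exprn_ege1.
Qed.

(** Integrate [inv_sqr_tangent] at [m = 2 + n p].  With c i j the mean of
    U i * U j, the bound on third moments summed over [k] gives at most
    c i j * m for the mean of U i * U j * N, so each pair keeps the weight
    3 - 2 = 1; the diagonal pairs contribute [b], the other ones [a ^+ 2]. *)
Lemma local_mean_sqr_ge :
  (n%:R * \int[P]_w ((y (Z0 w) * \1_S (Z0 w)) ^+ 2) +
   n%:R * (n%:R - 1) * (\int[P]_w (y (Z0 w) * \1_S (Z0 w))) ^+ 2) /
    (2 + n%:R * fine (P (Z0 @^-1` S))) ^+ 2 <=
  \int[P]_w (((\sum_(i < n) y (Z i w) * \1_S (Z i w)) /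
              (\sum_(i < n) \1_S (Z i w))) ^+ 2).
Proof.
rewrite -/p -[X in n%:R * X]/b -[X in X ^+ 2]/a.
set m := 2 + n%:R * p.
have m_gt0 : 0 < m by rewrite ltr_wpDr// mulr_ge0.
have T2NE w : T w ^+ 2 * N w =
    \sum_(i < n) \sum_(j < n) \sum_(k < n) U i w * U j w * I k w.
  rewrite T2E mulr_suml; apply: eq_bigr => i _.
  by rewrite mulr_suml; apply: eq_bigr => j _; rewrite mulr_sumr.
have intT2N : P.-integrable setT (EFin \o (fun w => T w ^+ 2 * N w)).
  under [X in EFin \o X]eq_fun do rewrite T2NE.
  by do 3 apply: integrable_sumR => ?.
have ET2 : \int[P]_w (T w ^+ 2) = \sum_(i < n) \sum_(j < n) c i j.
  under eq_Rintegral do rewrite T2E.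
  rewrite Rintegral_sum; last by move=> i; exact: integrable_sumR.
  by apply: eq_bigr => i _; rewrite Rintegral_sum.
have ET2N : \int[P]_w (T w ^+ 2 * N w) <= m * \int[P]_w (T w ^+ 2).
  under eq_Rintegral do rewrite T2NE.
  rewrite Rintegral_sum; last by move=> i; do 2 apply: integrable_sumR => ?.
  rewrite ET2 mulr_sumr; apply: ler_sum => i _.
  rewrite Rintegral_sum; last by move=> j; apply: integrable_sumR => ?.
  rewrite mulr_sumr; apply: ler_sum => j _.
  rewrite Rintegral_sum//.
  apply: le_trans (ler_sum _ (fun k _ => third_moment i j k)) _.
  rewrite -mulr_sumr !big_split/= mulrC.
  have one (l : 'I_n) : \sum_(k < n) (k == l)%:R = 1 :> R.
    by rewrite (bigD1 l)//= eqxx big1 ?addr0// => k /negbTE ->.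
  by rewrite !one sumr_const card_ord -[p *+ n]mulr_natl.
have sum_c : \sum_(i < n) \sum_(j < n) c i j =
    n%:R * b + n%:R * (n%:R - 1) * a ^+ 2.
  transitivity (\sum_(i < n) (b + (n%:R - 1) * a ^+ 2)).
    apply: eq_bigr => i _; rewrite (bigD1 i)//= c_diag; congr (_ + _).
    rewrite (eq_bigr (fun=> a ^+ 2)); last first.
      by move=> j; rewrite eq_sym => /c_off.
    rewrite sumr_const cardC1 card_ord -[_ *+ _]mulr_natl; congr (_ * _).
    by case: (n) i => [[]//|k] _; rewrite -[k.+1%:R]natr1 addrK.
  by rewrite sumr_const card_ord -[_ *+ n]mulr_natl mulrDr mulrA.
have int3 := integrable_mulrl 3 intT2.
have int2m := integrable_mulrl (2 / m) intT2N.
have int_diff : P.-integrable setT (EFin \o (fun w =>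
    3 * T w ^+ 2 - 2 / m * (T w ^+ 2 * N w))).
  exact: (integrableB measurableT int3 int2m).
apply: (@le_trans _ _ (\int[P]_w ((m ^+ 2)^-1 *
    (3 * T w ^+ 2 - 2 / m * (T w ^+ 2 * N w))))).
  rewrite RintegralZl// (RintegralB _ int3 int2m)// !RintegralZl//.
  rewrite mulrC ler_wpM2l ?invr_ge0 ?sqr_ge0// -sum_c -ET2.
  have : 2 / m * \int[P]_w (T w ^+ 2 * N w) <=
      2 / m * (m * \int[P]_w (T w ^+ 2)).
    by rewrite ler_wpM2l// divr_ge0// ltW.
  by rewrite [X in _ <= X]mulrA divfK ?gt_eqF//; lra.
apply: le_Rintegral => //.
- exact: integrable_mulrl.
- exact: local_mean_sqr_integrable.
by move=> w _; apply: inv_sqr_tangent => //; exact: T_eq0.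
Qed.

End local_mean.

(** * Volume and diameter of corner boxes *)

Section corner_boxes.
Context {R : realType}.

Lemma lebesgue_tuple0 d : lebesgue_tuple d (set0 : set (d.-tuple R)) = 0%E.
Proof.
elim: d => [|d IH]; first by rewrite /= diracE in_set0.
rewrite /= /pushforward preimage_set0 /product_measure1.
by under eq_integral do rewrite /= xsection0 IH; rewrite integral0.
Qed.

(** The section of a box at [x] is the box of the remaining sides if [x] lies in
    the first side and is empty otherwise, so the defining integral is that of
    a constant over an interval. *)
Lemma lebesgue_corner_box d (h : 'I_d -> R) : (forall k, 0 <= h k) ->
  lebesgue_tuple d (corner_box h) = (\prod_(k < d) h k)%:E.
Proof.
elim: d h => [|d IH] h h0; first by rewrite /= big_ord0 diracE mem_set// => -[].
rewrite /= /pushforward /product_measure1.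
set A := _ @^-1` _.
have secE x : lebesgue_tuple d (xsection A x) =
    ((cst (\prod_(k < d) h (lift ord0 k))%:E) \_ `[0, h ord0]%classic) x.
  rewrite patchE; case: ifPn => [|/negP]; rewrite inE/= in_itv/= => xh.
    rewrite -IH//; congr lebesgue_tuple.
    apply/seteqP; split => v; rewrite /xsection/= inE.
      by move=> Av k; have := Av (lift ord0 k); rewrite (tnthS x v).
    move=> vh k; have [j ->|->] := unliftP ord0 k; first by rewrite tnthS.
    by rewrite tnth0.
  rewrite -[RHS](lebesgue_tuple0 d); congr lebesgue_tuple.
  apply/seteqP; split => v //; rewrite /xsection/= inE => /(_ ord0).
  by rewrite tnth0 => /xh.
rewrite (eq_integral _ _ (fun x _ => secE x)) -integral_mkcond integral_cst//.
have := lebesgue_measure_itv `[0, h ord0]; rewrite /= lte_fin sube0 => ->.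
rewrite big_ord_recl EFinM muleC; congr (_ * _)%E; case: ifPn => //.
by rewrite -leNgt => h1; congr _%:E; apply/eqP; rewrite eq_le h0 h1.
Qed.

Lemma measurable_corner_box d (h : 'I_d -> R) : measurable (corner_box h).
Proof.
have -> : corner_box h = \bigcap_(k in [set: 'I_d])
    (fun x : d.-tuple R => tnth x k) @^-1` `[0, h k]%classic.
  apply/seteqP; split => x /= xh k.
    by move=> _ /=; rewrite in_itv/=; exact: xh.
  by have := xh k I; rewrite /= in_itv.
apply: fin_bigcap_measurable => // k _.
by rewrite -[X in measurable X]setTI; apply: measurable_tnth.
Qed.

Lemma sum_sqr_le d (h : 'I_d -> R) : (forall k, 0 <= h k) ->
  \sum_(k < d) h k ^+ 2 <= (\sum_(k < d) h k) ^+ 2.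
Proof.
move=> h0; rewrite [leRHS]expr2 mulr_suml; apply: ler_sum => k _.
by rewrite expr2 ler_wpM2l// (bigD1 k)//= lerDl sumr_ge0.
Qed.

Lemma dist2_corner_box d (h : 'I_d -> R) (x y : d.-tuple R) :
  corner_box h x -> corner_box h y -> dist2 x y <= \sum_(k < d) h k.
Proof.
move=> hx hy.
have h0 k : 0 <= h k by have /andP[] := hx k; exact: le_trans.
rewrite /dist2 -[leRHS]ger0_norm ?sumr_ge0// -sqrtr_sqr ler_wsqrtr//.
apply: le_trans (sum_sqr_le h0); apply: ler_sum => k _.
rewrite -[leLHS]real_normK ?num_real// ler_sqr ?nnegrE// ler_norml.
have := hx k; have := hy k; lra.
Qed.

Lemma diam_corner_box d (h : 'I_d -> R) : (forall k, 0 <= h k) ->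
  0 <= diam (corner_box h) <= \sum_(k < d) h k.
Proof.
move=> h0; rewrite /diam; set D := [set _ | _].
have box0 : corner_box h (zero_vec R d).
  by move=> k; rewrite tnth_mktuple lexx h0.
have D0 : D 0.
  exists (zero_vec R d), (zero_vec R d); split => //.
  rewrite /dist2 big1 ?sqrtr0// => k _; by rewrite subrr expr0n.
have ubD : ubound D (\sum_(k < d) h k).
  by move=> _ [x [y [hx hy ->]]]; exact: dist2_corner_box.
apply/andP; split; last by apply: ge_sup => //; exists 0.
by apply: ub_le_sup => //; exists (\sum_(k < d) h k).
Qed.

Lemma corner_box_sub_cube d (h : 'I_d -> R) : (forall k, 0 <= h k) ->
  corner_box h `<=` @unit_cube R d <-> (forall k, h k <= 1).
Proof.
move=> h0; split => [sub k|h1 x xh k].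
  have /sub/(_ k) : corner_box h [tuple h l | l < d].
    by move=> l; rewrite tnth_mktuple lexx h0.
  by rewrite tnth_mktuple => /andP[].
by have /andP[-> /le_trans->] := xh k.
Qed.

End corner_boxes.

(** * Moments of a response restricted to a box *)

Section observations_in_a_box.
Context {dO : measure_display} {Omega : measurableType dO} {R : realType}
  (P : probability Omega R) (d : nat).
Variables (X : {RV P >-> d.-tuple R}) (Y : {RV P >-> R}).
Hypothesis uniform : uniform_on_cube P X.
Variables (g : d.-tuple R -> R) (s2 : R).
Hypotheses (regression : is_condexp P X Y g)
  (additive : forall x, unit_cube x -> g x = \sum_(k < d) tnth x k)
  (noise : cond_second_moment P X (fun w => Y w - g (X w)) s2).
Variable h : 'I_d -> R.
Hypotheses (h_ge0 : forall k, 0 <= h k) (h_le1 : forall k, h k <= 1).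

Let B := corner_box h.
Let p := \prod_(k < d) h k.
Let H := \sum_(k < d) h k.

Lemma uniform_corner_box (h' : 'I_d -> R) :
  (forall k, 0 <= h' k) -> (forall k, h' k <= 1) ->
  P (X @^-1` corner_box h') = (\prod_(k < d) h' k)%:E.
Proof.
move=> h0 h1; rewrite uniform; last exact: measurable_corner_box.
by rewrite setIidl ?lebesgue_corner_box//; exact/corner_box_sub_cube.
Qed.

Let EB (h' : 'I_d -> R) :
  (forall k, 0 <= h' k) -> (forall k, h' k <= 1) ->
  \int[P]_w \1_(corner_box h') (X w) = \prod_(k < d) h' k.
Proof.
move=> h0 h1.
rewrite Rintegral_indic_preimage ?uniform_corner_box//.
exact: measurable_corner_box.
Qed.

Let m1 (h' : 'I_d -> R) :
  measurable_fun setT (fun w => \1_(corner_box h') (X w) : R).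
Proof.
apply: measurableT_comp => //; apply: measurable_indic.
exact: measurable_corner_box.
Qed.

Let int1 (h' : 'I_d -> R) :
  P.-integrable setT (EFin \o (fun w => \1_(corner_box h') (X w) : R)).
Proof. by apply: integrable_indic_preimage; exact: measurable_corner_box. Qed.

Let mgX : measurable_fun setT (fun w => g (X w)).
Proof. by have [mg _ _ _] := regression; exact: measurableT_comp. Qed.

Let mB : measurable B. Proof. exact: measurable_corner_box. Qed.

Let gB x : B x -> 0 <= g x <= H.
Proof.
move=> xB; rewrite additive; last exact: (iffRL (corner_box_sub_cube h_ge0)).
apply/andP; split; first by apply: sumr_ge0 => k _; have /andP[] := xB k.
by apply: ler_sum => k _; have /andP[] := xB k.
Qed.

Lemma response_square_integrable :
  P.-integrable setT (EFin \o (fun w => (Y w * \1_B (X w)) ^+ 2)).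
Proof.
have [_ int_e _ _] := noise.
apply: (@le_integrable _ _ _ _ _ measurableT _
  (EFin \o (fun w => 2 * (Y w - g (X w)) ^+ 2 + 2 * H ^+ 2))).
- apply/measurable_EFinP; apply: measurable_funX.
  by apply: measurable_funM => //; exact: m1.
- move=> w _ /=.
  have bound_ge0 : 0 <= 2 * (Y w - g (X w)) ^+ 2 + 2 * H ^+ 2.
    by have := sqr_ge0 (Y w - g (X w)); have := sqr_ge0 H; lra.
  rewrite lee_fin (ger0_norm bound_ge0) ger0_norm ?sqr_ge0// indicE.
  have [/set_mem/gB/andP[g0 gH]|_] := boolP (X w \in B); last first.
    by rewrite mulr0 expr0n.
  have : g (X w) ^+ 2 <= H ^+ 2 by rewrite ler_sqr ?nnegrE// (le_trans g0).
  rewrite mulr1; have := sqr_ge0 (Y w - 2 * g (X w)); nra.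
- have int_cst : P.-integrable setT (EFin \o cst (2 * H ^+ 2)).
    exact: finite_measure_integrable_cst.
  exact: (integrableD measurableT (integrableZl measurableT 2 int_e) int_cst).
Qed.

(** Halving side [k] of the box yields a subbox of half its volume, outside of
    which coordinate [k] is at least [h k / 2]: this coordinate contributes at
    least [(h k / 2) * (p / 2)]. *)
Lemma response_mean_ge : p * H / 4 <= \int[P]_w (Y w * \1_B (X w)).
Proof.
have [_ _ _ reg] := regression.
have -> : \int[P]_w (Y w * \1_B (X w)) = \int[P]_w (g (X w) * \1_B (X w)).
  by rewrite -Rintegral_preimage -[RHS]Rintegral_preimage /Rintegral reg.
pose half k l : R := if l == k then h k / 2 else h l.
have half0 k l : 0 <= half k l.
  by rewrite /half; case: ifP => // _; rewrite divr_ge0.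
have half1 k l : half k l <= 1.
  by rewrite /half; case: ifP => // _; have := h_le1 k; have := h_ge0 k; lra.
have prod_half k : \prod_(l < d) half k l = p / 2.
  rewrite /p (bigD1 k)//= [in RHS](bigD1 k)//= {1}/half eqxx mulrAC.
  congr (_ * _ / _); apply: eq_bigr => l /negbTE lk.
  by rewrite /half lk.
have int_diff k := integrableB measurableT (int1 h) (int1 (half k)).
have int_low k : P.-integrable setT (EFin \o (fun w =>
    h k / 2 * (\1_B (X w) - \1_(corner_box (half k)) (X w)))).
  exact: (integrableZl measurableT _ (int_diff k)).
apply: (@le_trans _ _ (\int[P]_w \sum_(k < d)
    h k / 2 * (\1_B (X w) - \1_(corner_box (half k)) (X w)))).
  rewrite Rintegral_sum// /H mulr_sumr mulr_suml; apply: ler_sum => k _.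
  rewrite RintegralZl//; last exact: int_diff.
  rewrite (RintegralB _ (int1 h) (int1 (half k)))// !EB// prod_half -/p; lra.
apply: le_Rintegral => //.
- exact: integrable_sumR.
- apply: (@le_integrable _ _ _ _ _ measurableT _ (EFin \o cst H)).
  + by apply/measurable_EFinP; apply: measurable_funM => //; exact: m1.
  + move=> w _ /=; rewrite lee_fin indicE.
    have H0 : 0 <= H by rewrite sumr_ge0.
    rewrite [leRHS]ger0_norm//.
    have [/set_mem/gB/andP[g0 gH]|_] := boolP (X w \in B).
      by rewrite mulr1 ger0_norm.
    by rewrite mulr0 normr0.
  + exact: finite_measure_integrable_cst.
- move=> w _; rewrite !indicE; have [/set_mem wB|wB] := boolP (X w \in B).
    rewrite mulr1 additive; last exact: (iffRL (corner_box_sub_cube h_ge0)).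
    apply: ler_sum => k _; have /andP[xk0 _] := wB k.
    rewrite indicE.
    have [_|wh] := boolP (X w \in corner_box (half k)).
      by rewrite subrr mulr0.
    rewrite subr0 mulr1 leNgt; apply: contra wh => xk.
    apply: mem_set => l; rewrite /half; case: eqP => [->|_]; last exact: wB.
    by rewrite xk0 ltW.
  rewrite mulr0 big1// => k _; rewrite indicE.
  suff /negbTE-> : X w \notin corner_box (half k) by rewrite subrr mulr0.
  apply: contra wB => /set_mem wh; apply: mem_set => l.
  have := wh l; rewrite /half; case: eqP => [->|//] /andP[-> /le_trans->]//.
  by have := h_ge0 k; lra.
Qed.

(** On the box the regression function lies between [0] and [H], and
    (e + g)^2 >= e^2 / 9 - g^2 / 8 for all reals.  The constants are chosen so
    that the loss in [H] is absorbed by the squared mean in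
    [bias_variance_lower_bound]. *)
Lemma response_second_moment_ge :
  s2 * p / 9 - H ^+ 2 * p / 8 <= \int[P]_w (Y w * \1_B (X w)) ^+ 2.
Proof.
have [_ int_e _ var] := noise.
have mXB : measurable (X @^-1` B).
  by rewrite -[X in measurable X]setTI; exact: measurable_funP.
have Ee : \int[P]_w ((Y w - g (X w)) ^+ 2 * \1_B (X w)) = s2 * p.
  rewrite -Rintegral_preimage /Rintegral var//.
  transitivity (fine (\int[P]_(w in X @^-1` B) cst s2%:E w)%E) => //.
  by rewrite integral_cst// [X in (_ * X)%E](uniform_corner_box h_ge0 h_le1).
have int_eB : P.-integrable setT (EFin \o (fun w =>
    (Y w - g (X w)) ^+ 2 * \1_B (X w))).
  apply: (le_integrable measurableT _ _ int_e).
    apply/measurable_EFinP; apply: measurable_funM; last exact: m1.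
    by apply: measurable_funX; exact: measurable_funB.
  move=> w _ /=; rewrite lee_fin normrM ler_piMr//.
  by rewrite indicE ger0_norm ?lern1 ?leq_b1.
have int_e9 := integrable_mulrl 9^-1 int_eB.
have int_H8 := integrable_mulrl (H ^+ 2 / 8) (int1 h).
apply: (@le_trans _ _ (\int[P]_w (9^-1 * ((Y w - g (X w)) ^+ 2 * \1_B (X w)) -
    H ^+ 2 / 8 * \1_B (X w)))).
  rewrite (RintegralB _ int_e9 int_H8)// !RintegralZl//.
  by rewrite Ee EB// -/p; lra.
apply: le_Rintegral => //.
- exact: (integrableB measurableT int_e9 int_H8).
- exact: response_square_integrable.
move=> w _; rewrite indicE.
have [/set_mem/gB/andP[g0 gH]|_] := boolP (X w \in B).
  rewrite !mulr1.
  have : g (X w) ^+ 2 <= H ^+ 2 by rewrite ler_sqr ?nnegrE// (le_trans g0).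
  (* With noise e and g = [g (X w)], this square is 72 times
     (e + g)^2 - e^2 / 9 + g^2 / 8. *)
  have := sqr_ge0 (8 * (Y w - g (X w)) + 9 * g (X w)); nra.
by rewrite !mulr0 subrr expr0n.
Qed.

End observations_in_a_box.

(** * The rate *)

(** A squared bias D^2 and a variance s2 / q, where [q] is at most proportional
    to D^d: if [D] is below the target [t], then [q] is small enough for the
    variance to exceed t^2. *)
Lemma rate_of_two_terms (R : realType) (d : nat) (M s2 q D t : R) :
  0 <= t -> 0 <= D -> 0 <= s2 -> 0 < q ->
  D ^+ 2 <= M -> s2 / q <= M -> t ^+ (d + 2) * q <= D ^+ d * s2 ->
  t ^+ 2 <= M.
Proof.
move=> t0 D0 s0 q0 DM sM tD; have [tleD|Dltt] := leP t D.
  by apply: le_trans DM; rewrite ler_sqr ?nnegrE.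
apply: le_trans sM; rewrite ler_pdivlMr//.
have td : 0 < t ^+ d by rewrite exprn_gt0// (le_lt_trans D0).
rewrite -(ler_pM2l td) mulrA -exprD; apply: (le_trans tD).
by rewrite ler_wpM2r// lerXn2r ?nnegrE// ltW.
Qed.

(** As [n * p >= 16], the loss [H ^+ 2 * q / 8] is at most
    [(H * q) ^+ 2 / 128] for [q = n * p], a quarter of the lower bound
    [(H * q) ^+ 2 / 32] on the squared mean term; the denominator is at most
    [(81 / 64) * q ^+ 2]. *)
Lemma bias_variance_lower_bound (R : realType) (n p H s2 a b : R) :
  0 < p <= 1 -> 16 <= n * p -> 0 <= H -> 0 <= s2 ->
  p * H / 4 <= a -> s2 * p / 9 - H ^+ 2 * p / 8 <= b ->
  let Q := (n * b + n * (n - 1) * a ^+ 2) / (2 + n * p) ^+ 2 in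
  (H / 16) ^+ 2 <= Q /\ (s2 / 64) / (n * p) <= Q.
Proof.
move=> /andP[p0 p1] np H0 s20 aH bs Q; set q := n * p in np Q *.
have n16 : 16 <= n by rewrite /q in np; nra.
have q0 : 0 < q by lra.
have num : s2 * q / 9 + 3 / 128 * (H * q) ^+ 2 <= n * b + n * (n - 1) * a ^+ 2.
  have nb : s2 * q / 9 - H ^+ 2 * q / 8 <= n * b.
    have -> : s2 * q / 9 - H ^+ 2 * q / 8 =
      n * (s2 * p / 9 - H ^+ 2 * p / 8) by rewrite /q; ring.
    by rewrite ler_wpM2l// (le_trans _ n16).
  have na : (H * q) ^+ 2 / 32 <= n * (n - 1) * a ^+ 2.
    have -> : (H * q) ^+ 2 / 32 = n ^+ 2 / 2 * (p * H / 4) ^+ 2.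
      by rewrite /q; field.
    have nn : n ^+ 2 / 2 <= n * (n - 1) by have := sqr_ge0 (n - 16); nra.
    apply: ler_pM => //; rewrite ?sqr_ge0// ?divr_ge0 ?sqr_ge0//.
    by rewrite ler_sqr ?nnegrE//; [|apply: le_trans aH];
      rewrite !mulr_ge0// ltW.
  have Hq : H ^+ 2 * q / 8 <= (H * q) ^+ 2 / 128.
    have -> : (H * q) ^+ 2 / 128 = H ^+ 2 * q / 8 * (q / 16) by field.
    apply: ler_peMr; last by rewrite ler_pdivlMr// mul1r.
    by apply: divr_ge0 => //; rewrite mulr_ge0 ?sqr_ge0// ltW.
  lra.
have den : (2 + q) ^+ 2 <= 81 / 64 * q ^+ 2 by nra.
have den0 : 0 < (2 + q) ^+ 2 by rewrite exprn_gt0//; lra.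
have sq : 0 <= s2 * q by rewrite mulr_ge0// ltW.
split; rewrite /Q ler_pdivlMr//; apply: le_trans num.
  have := ler_wpM2l (sqr_ge0 (H / 16)) den; have := sqr_ge0 (H * q).
  by rewrite !exprMn; lra.
have w0 : 0 <= s2 / 64 / q by rewrite !divr_ge0// ltW.
apply: le_trans (ler_wpM2l w0 den) _.
have -> : s2 / 64 / q * (81 / 64 * q ^+ 2) = 81 / 4096 * (s2 * q).
  by field; rewrite gt_eqF.
have := sqr_ge0 (H * q); lra.
Qed.

Lemma half_le_ln2 (R : realType) : 2^-1 <= ln 2 :> R.
Proof.
rewrite -[leLHS]expRK ler_ln ?posrE ?expR_gt0//.
have := expR_ge1Dx (- 2^-1 : R); rewrite expRN => e.
rewrite -[leLHS]invrK -[leRHS]invrK lef_pV2 ?posrE ?invr_gt0 ?expR_gt0//; lra.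
Qed.

Theorem proposition10 (R : realType) (d : nat) (hd : (1 <= d)%N) :
  exists C : R, 0 < C /\
  forall (n : nat) (hn : (1 <= n)%N)
    (dO : measure_display) (Omega : measurableType dO)
    (P : probability Omega R)
    (X0 : {RV P >-> d.-tuple R}) (Y0 : {RV P >-> R})
    (X : 'I_n -> {RV P >-> d.-tuple R}) (Y : 'I_n -> {RV P >-> R})
    (hiid : iid_copies P (fun i w => (X i w, Y i w)) (fun w => (X0 w, Y0 w)))
    (hunif : uniform_on_cube P X0)
    (g : d.-tuple R -> R)
    (hreg : is_condexp P X0 Y0 g)
    (hg : forall x, unit_cube x -> g x = \sum_(k < d) tnth x k)
    (sigma : R)
    (hsub : cond_subgaussian P X0 (fun w => Y0 w - g (X0 w)) (sigma ^+ 2))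
    (hvar : cond_second_moment P X0 (fun w => Y0 w - g (X0 w)) (sigma ^+ 2))
    (V : d.-tuple R -> set (d.-tuple R)) (hV : local_map V)
    (h : 'I_d -> R) (hV0 : V (zero_vec R d) = corner_box h)
    (gammabar : R) (hgamma : 0 < gammabar)
    (hdiam : (gammabar%:E <=
       (diam (V (zero_vec R d)) ^+ d)%:E
       / lebesgue_tuple d (V (zero_vec R d)))%E)
    (hsize : 2 ^+ (d + 4) * ln 2 <= n%:R * \prod_(k < d) h k),
    ((C * (gammabar * sigma ^+ 2 / n%:R) `^ (d + 2)%:R^-1)%:E <=
     'E_P[fun w =>
        ((local_estimator V X Y (zero_vec R d) w - g (zero_vec R d)) ^+ 2)%R]
       `^ 2^-1)%E.
Proof.
exists 16^-1; split; first by rewrite invr_gt0.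
move=> n hn dO Omega P X0 Y0 X Y hiid hunif g hreg hg sigma _ hvar V hV h hV0
  gammabar hgamma hdiam hsize.
have cube0 : unit_cube (zero_vec R d).
  by move=> k; rewrite tnth_mktuple lexx ler01.
have [_] := hV _ cube0; rewrite hV0 => box_cube box0.
have h_ge0 k : 0 <= h k by have /andP[] := box0 k; exact: le_trans.
have h_le1 := (corner_box_sub_cube h_ge0).1 box_cube.
set p := \prod_(k < d) h k in hsize; pose H := \sum_(k < d) h k.
have n0 : 0 < n%:R :> R by rewrite ltr0n.
have H0 : 0 <= H by rewrite sumr_ge0.
have np : 16 <= n%:R * p.
  apply: le_trans hsize; have -> : 16 = 2 ^+ 5 * 2^-1 :> R by field.
  rewrite ler_pM ?exprn_ge0 ?invr_ge0 ?half_le_ln2//.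
  by rewrite ler_weXn2l ?ler1n// -[5%N]/(1 + 4)%N leq_add2r.
have p0 : 0 < p by rewrite -(pmulr_rgt0 _ n0) (lt_le_trans _ np).
have p1 : p <= 1.
  by apply: (@numdomain.Num.Theory.prodr_ile1 R) => k _; rewrite h_ge0 h_le1.
have gamma_p : gammabar * p <= H ^+ d.
  have /andP[D0 DH] := diam_corner_box h_ge0.
  move: hdiam; rewrite hV0 lebesgue_corner_box// inver gt_eqF// lee_pdivlMr//.
  rewrite -EFinM lee_fin => /le_trans -> //.
  by rewrite lerXn2r ?nnegrE.
have mZ (X' : {RV P >-> d.-tuple R}) (Y' : {RV P >-> R}) :
    measurable_fun setT (fun w => (X' w, Y' w)).
  exact: measurable_fun_pair.
(* The observations, as random elements of the space of pairs. *)
pose Z i : {RV P >-> (d.-tuple R * R)%type} :=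
  HB.pack (fun w => (X i w, Y i w))
    (isMeasurableFun.Build _ _ _ _ _ (mZ (X i) (Y i))).
pose Z0 : {RV P >-> (d.-tuple R * R)%type} :=
  HB.pack (fun w => (X0 w, Y0 w))
    (isMeasurableFun.Build _ _ _ _ _ (mZ X0 Y0)).
pose S : set (d.-tuple R * R) := corner_box h `*` setT.
have mS : measurable S.
  by apply: measurableX => //; exact: measurable_corner_box.
have SE (x : d.-tuple R) (y : R) : \1_S (x, y) = \1_(corner_box h) x :> R.
  rewrite !indicE; congr _%:R; congr nat_of_bool.
  by apply/idP/idP; rewrite !inE /S/=; tauto.
have S0E : Z0 @^-1` S = X0 @^-1` corner_box h.
  by apply/seteqP; split => w; rewrite /S/=; tauto.
have int_u2 : P.-integrable setT (EFin \o (fun w =>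
    ((Z0 w).2 * \1_S (Z0 w)) ^+ 2)).
  have := response_square_integrable hg hvar h_ge0 h_le1.
  by apply: eq_integrable => // w _ /=; rewrite SE.
have mY : measurable_fun setT (fun z : (d.-tuple R * R)%type => z.2).
  exact: measurable_snd.
have iidZ : iid_copies P (fun i => Z i : Omega -> _) Z0 := hiid.
have estE w : local_estimator V X Y (zero_vec R d) w - g (zero_vec R d) =
    (\sum_(i < n) (Z i w).2 * \1_S (Z i w)) / \sum_(i < n) \1_S (Z i w).
  rewrite hg// big1 ?subr0; last by move=> k _; rewrite tnth_mktuple.
  rewrite /local_estimator hV0.
  by congr (_ / _); apply: eq_bigr => i _; rewrite SE.
under [X in 'E_P[X]%E]eq_fun do rewrite estE.
pose M := \int[P]_w (((\sum_(i < n) (Z i w).2 * \1_S (Z i w)) /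
              (\sum_(i < n) \1_S (Z i w))) ^+ 2).
have EM : 'E_P[fun w => (((\sum_(i < n) (Z i w).2 * \1_S (Z i w)) /
              (\sum_(i < n) \1_S (Z i w))) ^+ 2)%R]%E = M%:E.
  rewrite unlock /M /Rintegral fineK//; apply: integrable_fin_num => //.
  exact: local_mean_sqr_integrable iidZ _ _ mY mS int_u2.
rewrite EM poweR_EFin lee_fin.
have := local_mean_sqr_ge iidZ mY mS int_u2; rewrite -/M S0E.
rewrite (uniform_corner_box hunif h_ge0 h_le1)/= -/p.
under eq_Rintegral do rewrite SE.
under [X in _ + _ * X ^+ 2]eq_Rintegral do rewrite SE.
move=> MQ.
have p01 : 0 < p <= 1 by rewrite p0.
have [biasM varM] := bias_variance_lower_bound p01 np H0 (sqr_ge0 sigma)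
  (response_mean_ge hunif hreg hg h_ge0 h_le1)
  (response_second_moment_ge hunif hreg hg hvar h_ge0 h_le1).
have M0 : 0 <= M by rewrite Rintegral_ge0// => w _; exact: sqr_ge0.
rewrite powR12_sqrt//; set t := _ `^ _.
have t0 : 0 <= t by exact: powR_ge0.
have tE : t ^+ (d + 2) = gammabar * sigma ^+ 2 / n%:R.
  rewrite -powR_mulrn// /t -powRrM mulVf ?pnatr_eq0 ?addn2//.
  by rewrite powRr1//; apply: divr_ge0 => //; rewrite mulr_ge0 ?sqr_ge0// ltW.
rewrite -[leLHS]ger0_norm ?mulr_ge0 ?invr_ge0// -sqrtr_sqr ler_wsqrtr//.
(* Scaling target and bias by the same factor 16 leaves a factor 16^2, more than
   the 64 lost on the variance. *)
apply: (@rate_of_two_terms _ d _ (sigma ^+ 2 / 64) (n%:R * p) (H / 16)).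
- by rewrite mulr_ge0 ?invr_ge0.
- by rewrite divr_ge0.
- by rewrite divr_ge0 ?sqr_ge0.
- by rewrite mulr_gt0.
- exact: le_trans biasM MQ.
- exact: le_trans varM MQ.
rewrite exprMn tE exprD expr_div_n.
have -> : 16^-1 ^+ d * 16^-1 ^+ 2 * (gammabar * sigma ^+ 2 / n%:R) *
    (n%:R * p) = (16 ^+ d)^-1 * ((gammabar * p) * (sigma ^+ 2 / 256)).
  by rewrite -exprVn; field; rewrite gt_eqF.
have -> : H ^+ d / 16 ^+ d * (sigma ^+ 2 / 64) =
  (16 ^+ d)^-1 * (H ^+ d * (sigma ^+ 2 / 64)) by ring.
have s2_ge0 := sqr_ge0 sigma.
have s2_le : sigma ^+ 2 / 256 <= sigma ^+ 2 / 64 by lra.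
apply: ler_wpM2l; first by rewrite invr_ge0 exprn_ge0.
apply: ler_pM => //; first by rewrite mulr_ge0// ltW.
by rewrite divr_ge0.
Qed.
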